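(* For $c>0$, $u>0$, $0\le v\le 1$ let $\mathcal{C}_c(u,v)=Q\big(c+u,Q^{-1}(u,v)\big)=\Gamma\big(c+u,Q^{-1}(u,v)\big)/\Gamma(c+u)$. (i) For fixed $v\in[0,1]$, the function $(c,u)\mapsto\Gamma(c+u)\,\mathcal{C}_c(u,v)$, $c>0$, $u>0$, is $\mathrm{STP}_2$. (ii) For fixed $u>0$, the function $(c,v)\mapsto\mathcal{C}_c(u,v)$, $c>0$, $0\le v\le 1$, is $\mathrm{SRR}_\infty$.
   Context: For $u>0$, $v\ge 0$: $\Gamma(u,v)=\int_v^\infty x^{u-1}e^{-x}\,dx$ is the upper incomplete gamma function, $\Gamma(u)=\Gamma(u,0)$ is the gamma function, and $Q(u,v)=\Gamma(u,v)/\Gamma(u)$. For fixed $u>0$ the function $v\mapsto Q(u,v)$, $v\ge 0$, is strictly decreasing, and $v\mapsto Q^{-1}(u,v)$, $0\le v\le 1$, denotes the corresponding inverse function. Let $K(a,b)$ be a real function on a product $A\times B$ of subsets of $\mathbb{R}$. $K$ is $\mathrm{STP}_2$ (strictly totally positive of order 2) if for $r=1,2$, all $a_1>\cdots>a_r$ in $A$ and all $b_1>\cdots>b_r$ in $B$, the $r\times r$ determinant $\det(K(a_i,b_j))$ is $>0$. $K$ is $\mathrm{SRR}_\infty$ (strictly reverse-rule of order infinity) if $(-1)^{r(r-1)/2}\det(K(a_i,b_j))_{r\times r}>0$ for every $r\ge 1$ and all $a_1>\cdots>a_r$ in $A$, $b_1>\cdots>b_r$ in $B$.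
   Formalization: The value v=0 is excluded in both (i) and (ii), so v ranges over 0<v≤1: at v=0 one has Q^{-1}(u,0)=+∞ and C_c(u,0)=0 for all c,u, so the strict determinant inequalities fail there. *)

(* Defs.v *)
From HB Require Import structures.
From mathcomp Require Import all_boot all_order all_algebra.
From mathcomp Require Import all_classical all_reals all_analysis.

Set Implicit Arguments.
Unset Strict Implicit.
Unset Printing Implicit Defensive.

Import Order.TTheory GRing.Theory Num.Theory.
Import numFieldNormedType.Exports.

Local Open Scope classical_set_scope.
Local Open Scope ring_scope.

Section IncompleteGamma.
Variable R : realType.
Implicit Types (c u w : R) (v : \bar R).

(* The lower limit v is allowed to be +oo, where the integral is 0, so that
   v |-> Q(u,v) is a bijection from [0,+oo] onto the closed interval [0,1].
   For u > 0 and v >= 0 the integral is finite, hence equal to its real part. *)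
Definition upper_gamma u v : R :=
  \int[lebesgue_measure]_(x in [set x : R | (v <= x%:E)%E])
    (x `^ (u - 1) * expR (- x)).

Definition gamma u : R := upper_gamma u 0%E.

Definition Qgamma u v : R := upper_gamma u v / gamma u.

(* The inverse of Q(u,.) on [0,+oo]; in particular Q^{-1}(u,0) = +oo. *)
Definition Qgamma_inv u : R -> \bar R :=
  'pinv_(fun=> +oo%E) [set v | (0 <= v)%E] (Qgamma u).

Definition calC c u w : R := Qgamma (c + u) (Qgamma_inv u w).

End IncompleteGamma.

Section TotalPositivity.
Variable R : realType.
Implicit Types (A B : set R) (K : R -> R -> R).

Definition decreasing_in A r (a : 'I_r -> R) : Prop :=
  (forall i, A (a i)) /\ (forall i j : 'I_r, (i < j)%N -> a j < a i).

Definition kernel_det K r (a b : 'I_r -> R) : R :=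
  \det (\matrix_(i < r, j < r) K (a i) (b j)).

Definition STP2 A B K : Prop :=
  forall r (a b : 'I_r -> R), (1 <= r <= 2)%N ->
    decreasing_in A a -> decreasing_in B b -> 0 < kernel_det K a b.

Definition SRRoo A B K : Prop :=
  forall r (a b : 'I_r -> R), (1 <= r)%N ->
    decreasing_in A a -> decreasing_in B b ->
    0 < (-1) ^+ (r * (r - 1))./2 * kernel_det K a b.

End TotalPositivity.

(* Main.v *)
(* Everything rests on sign(det K(a_i, b_j)) = (-1)^(r(r-1)/2) for a
   decreasing and b increasing, proved by differencing consecutive columns and
   replacing each difference by a value of the integrand: first for the powers
   b^a (mean value theorem, induction on r), then for the upper incomplete
   gamma function Gamma(a, b) (integrals over successive intervals).  Since
   v |-> Q^{-1}(u, v) is decreasing, this is (ii) up to the row factors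
   1 / Gamma(c + u).

   For (i), c |-> Gamma(c, x) is strictly log-convex, so the 2 x 2 inequality
   holds when both columns use the same lower limit x.  The case r = 2 of the
   determinant result says that Gamma(a, x) / Gamma(b, x) is nondecreasing in x
   for a > b, hence also (with x = 0) that Q(u, x) and the quantile Q^{-1}(u, v)
   are nondecreasing in u, so passing to the true lower limits only helps. *)

Require Import Defs.
From mathcomp Require Import all_boot all_order all_algebra.
From mathcomp Require Import all_classical all_reals all_analysis.
From mathcomp Require Import measurable_realfun ring lra.

Import Order.TTheory GRing.Theory Num.Theory.
Import numFieldNormedType.Exports.

Local Open Scope classical_set_scope.
Local Open Scope ring_scope.

(** * Determinant identities and a column-replacement principle *)

Section Determinants.
Context {R : realType}.

Lemma det_scale_rows r (d : 'I_r -> R) (M : 'M[R]_r) :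
  \det (\matrix_(i, j) (d i * M i j)) = \prod_i d i * \det M.
Proof.
have -> : \matrix_(i, j) (d i * M i j) = diag_mx (\row_i d i) *m M.
  by apply/matrixP => i j; rewrite mul_diag_mx !mxE.
by rewrite det_mulmx det_diag; congr (_ * _); apply: eq_bigr => i _; rewrite mxE.
Qed.

Lemma det_scale_cols r (d : 'I_r -> R) (M : 'M[R]_r) :
  \det (\matrix_(i, j) (d j * M i j)) = \prod_i d i * \det M.
Proof.
rewrite -det_tr -[in RHS]det_tr -det_scale_rows.
by congr (\det _); apply/matrixP => i j; rewrite !mxE.
Qed.

(** The differencing is right multiplication by the unit lower bidiagonal matrix [U], of determinant
    1. The last column has no successor: the factor [(j.+1 < r)%:R] masks the out-of-range value of
    [F]. *)
Lemma det_col_diff r (F : 'I_r -> nat -> R) :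
  \det (\matrix_(i < r, j < r) F i j) =
  \det (\matrix_(i < r, j < r) (F i j - (j.+1 < r)%:R * F i j.+1)).
Proof.
pose U : 'M[R]_r := \matrix_(i, j) ((i == j)%:R - (i == j.+1 :> nat)%:R).
have detU : \det U = 1.
  rewrite det_trig; last first.
    apply/is_trig_mxP => i j ij; rewrite mxE.
    by rewrite -val_eqE !ltn_eqF ?subrr// ltnW.
  by rewrite big1// => i _; rewrite mxE eqxx ltn_eqF// subr0.
rewrite -[LHS]mulr1 -[X in _ * X = _]detU -det_mulmx; congr (\det _).
apply/matrixP => i j; rewrite !mxE.
under eq_bigr do rewrite !mxE mulrBr.
rewrite sumrB; congr (_ - _).
  rewrite (bigD1 j)//= eqxx mulr1 big1 ?addr0// => k /negbTE ->.
  by rewrite mulr0.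
case: ltnP => jr; last first.
  rewrite mul0r big1// => k _; rewrite ltn_eqF ?mulr0//.
  exact: leq_trans jr.
rewrite mul1r (bigD1 (Ordinal jr))//= eqxx mulr1 big1 ?addr0// => k.
by rewrite -val_eqE => /= /negbTE ->; rewrite mulr0.
Qed.

Lemma det_mx2 (M : 'M[R]_2) :
  \det M = M ord0 ord0 * M ord_max ord_max - M ord0 ord_max * M ord_max ord0.
Proof.
have l0 : lift ord0 ord0 = ord_max :> 'I_2 by apply/val_inj.
have l1 : lift ord_max ord0 = ord0 :> 'I_2 by apply/val_inj.
rewrite (expand_det_row _ ord0) !big_ord_recl big_ord0 addr0 /cofactor.
by rewrite !det_mx11 !mxE !l0 !l1 /= expr0 expr1 mul1r mulN1r mulrN.
Qed.

(* Expanding along one column at a time, the determinant is a combination of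
   the f i with fixed coefficients, to which the hypothesis on M applies. *)
Lemma det_functional_gt0 r (s : R) (f : 'I_r -> R -> R) (I : 'I_r -> set R)
    (M : 'M[R]_r) :
  (forall t, (forall j, I j (t j)) -> 0 < s * \det (\matrix_(i, j) f i (t j))) ->
  (forall j a, (forall x, I j x -> 0 < \sum_i a i * f i x) ->
     0 < \sum_i a i * M i j) ->
  (forall j, I j !=set0) ->
  0 < s * \det M.
Proof.
move=> f_gt0 M_gt0 I0.
(* Interpolates between the two matrices: [k = 0] gives the values of the [f i], [k = r] gives
   [M]. *)
pose A k t : 'M[R]_r := \matrix_(i, j) if (j < k)%N then M i j else f i (t j).
have Ak k t : (k <= r)%N -> (forall j, I j (t j)) -> 0 < s * \det (A k t).
  elim: k t => [|k IH] t kr It.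
    have -> : A 0 t = \matrix_(i, j) f i (t j) by apply/matrixP => i j; rewrite !mxE.
    exact: f_gt0.
  pose l := Ordinal kr.
  have -> : s * \det (A k.+1 t) =
      \sum_i s * cofactor (A k.+1 t) i l * M i l.
    rewrite (expand_det_col _ l) mulr_sumr; apply: eq_bigr => i _.
    by rewrite !mxE /= ltnSn; ring.
  apply: M_gt0 => x Ix.
  (* Moving only the [l]-th point leaves the cofactors along column [l] unchanged, so they can serve
     as the fixed coefficients. *)
  pose t' j := if j == l then x else t j.
  have It' j : I j (t' j) by rewrite /t'; case: eqP => [->|].
  rewrite [ltRHS](_ : _ = s * \det (A k t')) ?IH//; first exact: ltnW.
  rewrite (expand_det_col _ l) mulr_sumr; apply: eq_bigr => i _.
  have -> : cofactor (A k.+1 t) i l = cofactor (A k t') i l.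
    rewrite /cofactor; congr (_ * \det _); apply/matrixP => a b; rewrite !mxE.
    rewrite /t' [lift l b == l]eq_sym (negbTE (neq_lift _ _)) ltnS leq_eqVlt.
    by have := neq_lift l b; rewrite -val_eqE eq_sym => /negbTE ->.
  by rewrite !mxE /= ltnn /t' eqxx; ring.
have [t It] := choice I0.
have := Ak r t (leqnn r) It; rewrite (_ : A r t = M)//.
by apply/matrixP => i j; rewrite !mxE ltn_ord.
Qed.

End Determinants.

(** * Generalized Vandermonde determinants with real exponents *)

Section Vandermonde.
Context {R : realType}.

(** Sign bookkeeping for the induction below: dropping one row and column changes the triangular
    exponent by [r], which the sign reversal of [r] columns compensates. *)
Lemma rev_sign_recl r :
  (-1) ^+ (r.+1 * (r.+1 - 1))./2 * (-1) ^+ r = (-1) ^+ (r * (r - 1))./2 :> R.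
Proof.
have -> : ((r.+1 * (r.+1 - 1))./2 = (r * (r - 1))./2 + r)%N.
  case: r => // r.
  have -> : (r.+2 * (r.+2 - 1) = r.+1 * (r.+1 - 1) + r.+1.*2)%N.
    by rewrite !subn1 /= -muln2 -mulnDr addn2 mulnC.
  by rewrite halfD odd_double andbF add0n doubleK.
by rewrite exprD -mulrA -expr2 sqrr_sign mulr1.
Qed.

(* Dividing out the smallest exponent makes the last row constant; after
   differencing the columns, the determinant shrinks by one and the entries are
   increments of powers, which the mean value theorem turns into powers again. *)
Lemma gen_vandermonde r (c t : 'I_r -> R) :
  (forall i j : 'I_r, (i < j)%N -> c j < c i) ->
  (forall j, 0 < t j) -> (forall i j : 'I_r, (i < j)%N -> t i < t j) ->
  0 < (-1) ^+ (r * (r - 1))./2 * \det (\matrix_(i, j) t j `^ c i).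
Proof.
elim: r c t => [|r IH] c t cD t0 tI; first by rewrite det_mx00 mul1r.
pose c' i := c i - c ord_max.
(* Extends the points to natural indices, so that [s k.+1] can be written without a bound on [k]. *)
pose s k := t (inord k).
have sE (j : 'I_r.+1) : s j = t j by rewrite /s inord_val.
have s0 k : 0 < s k by exact: t0.
have sI k : (k < r)%N -> s k < s k.+1.
  by move=> kr; apply: tI; rewrite !inordK// ltnW.
have c'0 (i : 'I_r) : 0 < c' (lift ord_max i).
  by rewrite subr_gt0; apply: cD; rewrite lift_max.
have -> : \matrix_(i, j) t j `^ c i =
    \matrix_(i, j) (t j `^ c ord_max *
      (\matrix_(i < r.+1, j < r.+1) s j `^ c' i) i j).
  apply/matrixP => i j; rewrite !mxE sE -powRD.
    by congr (_ `^ _); rewrite /c'; ring.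
  by apply/implyP => _; rewrite gt_eqF.
rewrite det_scale_cols mulrCA pmulr_rgt0; last first.
  by apply: prodr_gt0 => i _; exact: powR_gt0.
rewrite (det_col_diff _ (fun i k => s k `^ c' i)).
(* The last row has exponent 0, so its differences vanish except in the undifferenced last column,
   where the entry is 1. *)
rewrite (expand_det_row _ ord_max) (bigD1 ord_max)//= big1 ?addr0; last first.
  move=> j jmax; rewrite mxE /c' subrr !powRr0 mulr1.
  rewrite (_ : (j.+1 < r.+1)%N) ?subrr ?mul0r//.
  by rewrite ltnS ltn_neqAle leq_ord andbT; move: jmax; rewrite -val_eqE.
rewrite mxE ltnn mul0r subr0 /c' subrr powRr0 mul1r -/c'.
rewrite /cofactor addnn -mul2n exprM sqrrN expr1n expr1n mul1r.
pose M : 'M[R]_r := \matrix_(i, j)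
  (s j.+1 `^ c' (lift ord_max i) - s j `^ c' (lift ord_max i)).
rewrite [X in \det X](_ : _ = -1 *: M); last first.
  apply/matrixP => i j; rewrite !mxE lift_max ltnS ltn_ord.
  by rewrite (_ : true%:R = 1 :> R)// -/(c' _); ring.
rewrite detZ mulrA rev_sign_recl.
apply: (@det_functional_gt0 _ _ _
  (fun i x => c' (lift ord_max i) * x `^ (c' (lift ord_max i) - 1))
  (fun j => `]s j, s j.+1[%classic)) => [x xI|j a a_gt0|j].
- have -> : \matrix_(i, j) (c' (lift ord_max i) *
      x j `^ (c' (lift ord_max i) - 1)) = \matrix_(i, j) (c' (lift ord_max i) *
      (\matrix_(i < r, j < r) x j `^ (c' (lift ord_max i) - 1)) i j).
    by apply/matrixP => i j; rewrite !mxE.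
  rewrite det_scale_rows mulrCA pmulr_rgt0; last exact: prodr_gt0.
  apply: IH => [i j ij|j|i j ij].
  + by rewrite /c' !ltrD2r; apply: cD; rewrite !lift_max.
  + by have := xI j; rewrite /= in_itv/= => /andP[+ _]; exact: lt_trans.
  + have := xI i; have := xI j; rewrite /= !in_itv/= => /andP[jx _] /andP[_ xi].
    apply: (lt_trans xi); apply: le_lt_trans jx.
    move: ij; rewrite leq_eqVlt => /predU1P[->//|ij].
    apply/ltW/tI; rewrite !inordK//; apply: ltnW; rewrite ltnS//.
    exact: leq_trans ij (ltnW (ltn_ord j)).
- have jr : (j < r)%N by [].
  (* The mean value theorem is applied to the whole combination: one intermediate point must serve
     all rows of the column. *)
  pose g x := \sum_i a i * x `^ c' (lift ord_max i).
  pose dg x := \sum_i a i * (c' (lift ord_max i) * x `^ (c' (lift ord_max i) - 1)).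
  have dgE (x : R) : 0 < x -> is_derive x 1 g (dg x).
    move=> x0; rewrite /g /dg.
    have -> : (fun x => \sum_i a i * x `^ c' (lift ord_max i)) =
        \sum_i (a i \*: (fun x => x `^ c' (lift ord_max i))).
      by apply/funext => y; rewrite fct_sumE.
    apply: is_derive_sum => i.
    by apply: is_deriveZ; exact: is_derive1_powR.
  have [||x xI] := @MVT _ g dg (s j) (s j.+1) (sI _ jr).
  + move=> x; rewrite in_itv/= => /andP[jx _]; apply: dgE.
    exact: lt_trans jx.
  + apply: derivable_within_continuous => x; rewrite in_itv/= => /andP[jx _].
    by have [] := dgE x (lt_le_trans (s0 _) jx).
  + move=> gE.
    rewrite (_ : \sum_i _ = g (s j.+1) - g (s j)); last first.
      by rewrite -sumrB; apply: eq_bigr => i _; rewrite mxE mulrBr.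
    by rewrite gE mulr_gt0 ?subr_gt0 ?sI//; exact: a_gt0.
- exists ((s j + s j.+1) / 2); rewrite /= in_itv/=.
  by have := sI j (ltn_ord j); lra.
Qed.

End Vandermonde.

(** * Integrability of the gamma integrand *)

Section GammaDensity.
Context {R : realType}.
Local Notation mu := (@lebesgue_measure R).

Definition gamma_density (c x : R) : R := x `^ (c - 1) * expR (- x).

Lemma gamma_density_ge0 c x : 0 <= gamma_density c x.
Proof. by rewrite mulr_ge0 ?powR_ge0 ?expR_ge0. Qed.

Lemma gamma_density_gt0 c x : 0 < x -> 0 < gamma_density c x.
Proof. by move=> x0; rewrite mulr_gt0 ?powR_gt0 ?expR_gt0. Qed.

Lemma gamma_densityD c d x : 0 < x ->
  gamma_density (c + d) x = x `^ d * gamma_density c x.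
Proof.
move=> x0; rewrite /gamma_density mulrA -powRD; last first.
  by apply/implyP => _; rewrite gt_eqF.
by congr (_ `^ _ * _); ring.
Qed.

Lemma measurable_gamma_density c (D : set R) :
  measurable_fun D (gamma_density c).
Proof.
apply: measurable_funTS; apply: measurable_funM; first exact: measurable_powR.
by apply: measurableT_comp => //; exact: measurable_funN.
Qed.

(** Half of the exponential decay absorbs the power: the term of order [n], with [n] above [p], in
    the series of [expR (2^-1 * x)] already dominates it up to a constant. *)
Lemma powR_expR_bounded (p : R) :
  exists2 C, 0 <= C &
    forall x, 1 <= x -> x `^ p * expR (- x) <= C * expR (- (2^-1 * x)).
Proof.
pose n := (Num.truncn `|p|).+1.
exists (2 ^+ n * n`!%:R); first by rewrite mulr_ge0.
move=> x x1; have x0 : 0 < x by lra.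
have -> : expR (- x) = expR (- (2^-1 * x)) * expR (- (2^-1 * x)).
  by rewrite -expRD; congr expR; lra.
rewrite mulrA ler_wpM2r ?expR_ge0// expRN ler_pdivrMr ?expR_gt0//.
have pn : p <= n%:R by rewrite (le_trans (ler_norm _))// ltW// truncnS_gt.
rewrite (le_trans (ler_powR x1 pn))// powR_mulrn; last exact: ltW.
have := expR_ge1Dxn (Num.truncn `|p|) (ltW (_ : 0 < 2^-1 * x)).
rewrite -/n => /(_ ltac:(lra)) h.
have -> : x ^+ n = 2 ^+ n * n`!%:R * ((2^-1 * x) ^+ n / n`!%:R).
  rewrite exprMn exprVn; field.
  by rewrite expf_neq0//= pnatr_eq0 -lt0n fact_gt0.
by rewrite ler_wpM2l ?mulr_ge0// (le_trans _ h)// lerDr.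
Qed.

Lemma integrable_gamma_density_infty c :
  mu.-integrable `[1, +oo[ (EFin \o gamma_density c).
Proof.
have [C C0 CP] := powR_expR_bounded (c - 1).
have r0 : (0 : R) < 2^-1 by lra.
(* The factor 2 cancels the normalization [2^-1] of the exponential density. *)
have /(integrableZl measurableT (2 * C)) i1 := integrable_exponential_pdf r0.
have : mu.-integrable `[1, +oo[
    (fun x => (2 * C)%:E * (EFin \o exponential_pdf 2^-1) x)%E.
  by apply: integrableS i1.
apply: le_integrable => //.
  apply/measurable_EFinP; exact: measurable_gamma_density.
move=> x /=; rewrite in_itv/= andbT => x1.
rewrite lee_fin !ger0_norm ?gamma_density_ge0//; last first.
  by rewrite !mulr_ge0// exponential_pdf_ge0// ltW.
rewrite /exponential_pdf patchE ifT; last first.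
  by rewrite inE/= in_itv/= andbT; lra.
rewrite (le_trans (CP _ x1))// mulNr; lra.
Qed.

Lemma integrable_gamma_density_zero c : 0 < c ->
  mu.-integrable `]0, 1] (EFin \o gamma_density c).
Proof.
move=> c0.
have mp (D : set R) : measurable_fun D (fun x => (x `^ (c - 1))%:E).
  by apply/measurable_EFinP/measurable_funTS; exact: measurable_powR.
have : mu.-integrable `]0, 1] (fun x => (x `^ (c - 1))%:E); last first.
  apply: le_integrable => //.
    apply/measurable_EFinP; exact: measurable_gamma_density.
  move=> x /=; rewrite in_itv/= => /andP[x0 _].
  rewrite lee_fin !ger0_norm ?gamma_density_ge0 ?powR_ge0//.
  by rewrite ler_piMr ?powR_ge0// expR_le1; lra.
apply/integrableP; split; first exact: mp.
under eq_integral do rewrite /= ger0_norm ?powR_ge0//.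
pose F n := `[n.+1%:R^-1, 1 : R]%classic.
have FE : `]0, 1]%classic = \bigcup_n F n.
  apply/seteqP; split => [x|x [n _]]; rewrite /F /= !in_itv/=.
    move=> /andP[x0 x1]; exists (Num.truncn x^-1) => //=.
    by rewrite in_itv/= x1 andbT invf_ple ?posrE// ltW// truncnS_gt.
  by move=> /andP[xn ->]; rewrite andbT (lt_le_trans _ xn).
have Fle n : (\int[mu]_(x in F n) (x `^ (c - 1))%:E <= (c^-1)%:E)%E.
  have n1 : n.+1%:R^-1 <= 1 :> R by rewrite invf_le1 ?ler1n.
  (* The interval degenerates to a point for [n = 0]; the fundamental theorem of calculus needs
     distinct endpoints. *)
  rewrite le_eqVlt in n1; case/predU1P: n1 => [n1|n1].
    by rewrite /F n1 set_itv1 integral_set1 lee_fin invr_ge0 ltW.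
  have n0 : 0 < n.+1%:R^-1 :> R by [].
  rewrite (@continuous_FTC2 _ _ (fun x => c^-1 * x `^ c))//.
  - rewrite powR1 mulr1 -EFinB lee_fin gerBl mulr_ge0 ?powR_ge0// invr_ge0.
    exact: ltW.
  - apply: derivable_within_continuous => x; rewrite in_itv/= => /andP[xn _].
    apply: derivable_powR; rewrite in_itv/= andbT; exact: lt_le_trans xn.
  - have d x : 0 < x -> derivable (fun x => c^-1 * x `^ c : R) x 1.
      move=> x0; apply: derivableM => //.
      by apply: derivable_powR; rewrite in_itv/= andbT.
    have cts x : 0 < x -> {for x, continuous (fun x => c^-1 * x `^ c : R)}.
      by move=> x0; apply/differentiable_continuous/derivable1_diffP/d.
    split.
    + move=> x; rewrite in_itv/= => /andP[xn _]; apply: d; exact: lt_trans xn.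
    + exact/cvg_at_right_filter/cts.
    + exact/cvg_at_left_filter/cts.
  - move=> x; rewrite in_itv/= => /andP[xn _].
    have x0 := lt_trans n0 xn.
    have dx : is_derive (x : R) 1 (c^-1 \*: (fun y : R => y `^ c))
        (c^-1 *: (c * x `^ (c - 1))).
      by apply: is_deriveZ; exact: is_derive1_powR.
    rewrite derive1E (_ : (fun _ => _) = c^-1 \*: (fun y : R => y `^ c))//.
    by rewrite derive_val /GRing.scale/= mulrA mulVf ?mul1r// gt_eqF.
rewrite FE.
have cvgF := @ge0_nondecreasing_set_cvg_integral _ (measurableTypeR R) _ F
  (fun x => (x `^ (c - 1))%:E) mu.
apply: le_lt_trans (ltry c^-1).
apply: (closed_cvg (fun x => (x <= (c^-1)%:E)%E) _ _ _ (cvgF _ _ _ _)) => //.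
- exact: closed_ereal_ge_ereal.
- exact: nearW.
- apply/nondecreasing_seqP => n; rewrite subsetEset; apply: subset_itvr.
  by rewrite bnd_simp lef_pV2 ?posrE// ler_nat.
- by move=> n; exact: measurable_itv.
- by move=> n; exact: mp.
- by move=> n x _; rewrite lee_fin powR_ge0.
Qed.

Lemma integrable_gamma_density c (D : set R) : 0 < c -> measurable D ->
  D `<=` `[0, +oo[ -> mu.-integrable D (EFin \o gamma_density c).
Proof.
move=> c0 mD D0.
suff i0y : mu.-integrable `]0, +oo[ (EFin \o gamma_density c).
  have mf : measurable_fun D (EFin \o gamma_density c).
    by apply/measurable_EFinP; exact: measurable_gamma_density.
  (* The possible singularity at 0 is discarded as a null set. *)
  apply/(@negligible_integrable _ (measurableTypeR R) _ mu D [set 0]) => //.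
    exact: lebesgue_measure_set1.
  apply: integrableS i0y => //; first exact: measurableD.
  move=> x [/D0]; rewrite /= !in_itv/= !andbT le_eqVlt.
  by move=> /predU1P[->|].
rewrite (@itv_bndbnd_setU _ _ _ (BRight 1)) ?bnd_simp//.
have /integrableP[m0 i0] := integrable_gamma_density_zero c c0.
have : mu.-integrable `]1, +oo[ (EFin \o gamma_density c).
  apply: integrableS (integrable_gamma_density_infty c) => //.
  by apply: subset_itvr; rewrite bnd_simp.
move=> /integrableP[m1 i1].
apply/integrableP; split.
  by apply/measurable_EFinP; exact: measurable_gamma_density.
rewrite ge0_integral_setU//=; first exact: lte_add_pinfty.
  apply/measurable_EFinP; apply: measurableT_comp => //.
  exact: measurable_gamma_density.
apply/disj_setPS => x []/=; rewrite !in_itv/= => /andP[_ x1].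
by rewrite andbT ltNge x1.
Qed.

End GammaDensity.

(** * Strict positivity and linearity of real integrals *)

Section RintegralFacts.
Context {R : realType}.
Local Notation mu := (@lebesgue_measure R).

(** A zero integral would make [f] vanish almost everywhere, putting [D] inside a null set together
    with [z]. The exceptional point accommodates the integrand of the log-convexity argument, which
    vanishes at one point. *)
Lemma Rintegral_gt0 (D : set (measurableTypeR R)) (f : R -> R) (z : R) :
  measurable D -> (0 < mu D)%E -> mu.-integrable D (EFin \o f) ->
  (forall x, D x -> 0 <= f x) -> (forall x, D x -> x != z -> 0 < f x) ->
  0 < \int[mu]_(x in D) f x.
Proof.
move=> mD D0 intf f0 f1; rewrite lt_neqAle Rintegral_ge0// andbT.
apply/negP => /eqP /esym int0.
have [mf _] := integrableP _ _ _ intf.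
have : (\int[mu]_(x in D) `|(EFin \o f) x| = 0)%E.
  rewrite -[RHS]/(0%:E) -[in RHS]int0 /Rintegral fineK; last exact: integrable_fin_num.
  by apply: eq_integral => x /[!inE] Dx; rewrite /= ger0_norm// f0.
move=> /(ae_eq_integral_abs mu mD mf) [N [mN N0 subN]].
have DN : D `<=` N `|` [set z].
  move=> x Dx; have [->|xz] := eqVneq x z; [by right|left].
  apply: subN => /= /(_ Dx) [fx0].
  by have := f1 _ Dx xz; rewrite fx0 ltxx.
have := le_measure mu _ _ DN.
rewrite !inE => /(_ mD (measurableU _ _ mN (measurable_set1 z))).
apply/negP; rewrite -ltNge (le_lt_trans _ D0)//.
rewrite (le_trans (measureU2 _ _ _))// [X in (X + _)%E]N0.
by rewrite [X in (_ + X)%E]lebesgue_measure_set1 adde0.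
Qed.

Lemma Rintegral_lincomb (D : set (measurableTypeR R)) r (a : 'I_r -> R)
    (f : 'I_r -> R -> R) :
  measurable D -> (forall i, mu.-integrable D (EFin \o f i)) ->
  mu.-integrable D (EFin \o (fun x => \sum_i a i * f i x)) /\
  \int[mu]_(x in D) (\sum_i a i * f i x) =
  \sum_i a i * \int[mu]_(x in D) f i x.
Proof.
move=> mD intf.
rewrite (_ : (fun x => \sum_i a i * f i x) =
             \sum_i (fun x => a i * f i x)); last first.
  by apply/funext => x; rewrite fct_sumE.
pose P (g : R -> R) v :=
  mu.-integrable D (EFin \o g) /\ \int[mu]_(x in D) g x = v.
have : P (\sum_i (fun x => a i * f i x))
         (\sum_i a i * \int[mu]_(x in D) f i x).
  apply: big_ind2 => [|g v h w [ig gv] [ih hw]|i _].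
  - split; first exact: integrable0.
    by rewrite (_ : (fun _ => _) = cst 0)// Rintegral_cst// mul0r.
  - split; first exact: (integrableD mD ig ih).
    by rewrite -gv -hw -RintegralD.
  - split; last by rewrite RintegralZl.
    exact: (integrableZl mD (a i) (intf i)).
by case=> ig <-; split=> //; apply: eq_Rintegral => x _; rewrite fct_sumE.
Qed.

End RintegralFacts.

(** * The upper incomplete gamma function and the sign of its determinants *)

Section UpperGamma.
Context {R : realType}.
Local Notation mu := (@lebesgue_measure R).
Implicit Types c x y : R.
Local Notation G c x := (upper_gamma c x%:E).

(** Leaving out the left endpoint lets successive intervals tile disjointly and keeps the integrand
    positive on the domain even when [x = 0]. *)
Lemma upper_gammaE c x : 0 < c -> 0 <= x ->
  G c x = \int[mu]_(t in `]x, +oo[) gamma_density c t.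
Proof.
move=> c0 x0; rewrite Rintegral_itv_obnd_cbnd; last first.
  apply: integrable_gamma_density => // t /=; rewrite !in_itv/= !andbT.
  by move=> /ltW; exact: le_trans.
rewrite /upper_gamma (_ : [set t | _] = `[x, +oo[%classic)//.
by apply/seteqP; split=> t /=; rewrite in_itv/= andbT lee_fin.
Qed.

Lemma upper_gamma_split c x y : 0 < c -> 0 <= x -> x <= y ->
  G c x = \int[mu]_(t in `]x, y]) gamma_density c t + G c y.
Proof.
move=> c0 x0 xy; rewrite !upper_gammaE//; last exact: le_trans xy.
rewrite (@itv_bndbnd_setU _ _ _ (BRight y)) ?bnd_simp//.
rewrite Rintegral_setU//.
- apply: integrable_gamma_density => //; first exact: measurableU.
  move=> t [|]/=; rewrite !in_itv/= ?andbT.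
    by move=> /andP[/ltW + _]; exact: le_trans.
  by move=> /ltW; apply: le_trans; exact: le_trans xy.
- apply/disj_setPS => t []/=; rewrite !in_itv/= => /andP[_ ty].
  by rewrite andbT ltNge ty.
Qed.

Lemma upper_gammay c : upper_gamma c +oo%E = 0.
Proof.
rewrite /upper_gamma (_ : [set t | _] = set0) ?Rintegral_set0//.
by apply/seteqP; split=> // t /=; rewrite leye_eq.
Qed.

Lemma upper_gamma_gt0 c x : 0 < c -> 0 <= x -> 0 < G c x.
Proof.
move=> c0 x0; rewrite upper_gammaE//; apply: (@Rintegral_gt0 _ _ _ x) => //.
- by rewrite lebesgue_measure_itv/= !ltry.
- apply: integrable_gamma_density => // t /=; rewrite !in_itv/= !andbT.
  by move=> /ltW; exact: le_trans.
- by move=> t _; exact: gamma_density_ge0.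
- move=> t /=; rewrite in_itv/= andbT => xt _.
  exact/gamma_density_gt0/(le_lt_trans x0).
Qed.

Lemma gamma_gt0 c : 0 < c -> 0 < gamma c.
Proof. by move=> c0; exact: upper_gamma_gt0. Qed.

Lemma upper_gamma_nincr c x y : 0 < c -> 0 <= x -> x <= y -> G c y <= G c x.
Proof.
move=> c0 x0 xy; rewrite (@upper_gamma_split c x y)// lerDr.
by apply: Rintegral_ge0 => t _; exact: gamma_density_ge0.
Qed.

Lemma upper_gamma_decr c x y : 0 < c -> 0 <= x -> x < y -> G c y < G c x.
Proof.
move=> c0 x0 xy; rewrite (@upper_gamma_split c x y)// ?ltrDr; last exact: ltW.
apply: (@Rintegral_gt0 _ _ _ x) => //.
- by rewrite lebesgue_measure_itv/= lte_fin xy -EFinB lte_fin subr_gt0.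
- apply: integrable_gamma_density => // t /=; rewrite !in_itv/= andbT.
  by move=> /andP[/ltW + _]; exact: le_trans.
- by move=> t _; exact: gamma_density_ge0.
- move=> t /=; rewrite in_itv/= => /andP[xt _] _.
  exact/gamma_density_gt0/(le_lt_trans x0).
Qed.

(* The columns are differenced, so that the entries become integrals of the
   density over successive intervals. *)
Lemma det_upper_gamma r (c x : 'I_r -> R) :
  (forall i, 0 < c i) -> (forall i j : 'I_r, (i < j)%N -> c j < c i) ->
  (forall j, 0 <= x j) -> (forall i j : 'I_r, (i < j)%N -> x i < x j) ->
  0 < (-1) ^+ (r * (r - 1))./2 * \det (\matrix_(i, j) G (c i) (x j)).
Proof.
case: r c x => [|r] c x c0 cD x0 xI; first by rewrite det_mx00 mul1r.
pose s k := x (inord k).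
have sE (j : 'I_r.+1) : s j = x j by rewrite /s inord_val.
have s0 k : 0 <= s k by exact: x0.
have sI k l : (k < l)%N -> (l < r.+1)%N -> s k < s l.
  by move=> kl lr; apply: xI; rewrite !inordK// (ltn_trans kl).
have -> : \matrix_(i, j) G (c i) (x j) =
    \matrix_(i < r.+1, j < r.+1) G (c i) (s j).
  by apply/matrixP => i j; rewrite !mxE sE.
rewrite (det_col_diff _ (fun i k => G (c i) (s k))).
(* The last interval is unbounded, matching the last column, which is not differenced. *)
pose I (j : 'I_r.+1) : interval R :=
  Interval (BRight (s j)) (if (j.+1 < r.+1)%N then BRight (s j.+1) else +oo%O).
have I_gt j t : t \in I j -> s j < t.
  by rewrite itv_boundlr/= => /andP[].
have I_le (i j : 'I_r.+1) t : (i < j)%N -> t \in I i -> t <= s j.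
  move=> ij; have ir : (i.+1 < r.+1)%N by exact: leq_ltn_trans (ltn_ord j).
  rewrite itv_boundlr ir/= => /andP[_]; rewrite bnd_simp => ts.
  apply: le_trans ts _.
  move: ij; rewrite leq_eqVlt => /predU1P[->//|ij].
  by apply/ltW/sI.
have iI i j : mu.-integrable [set` I j] (EFin \o gamma_density (c i)).
  apply: integrable_gamma_density => // t /= /I_gt st.
  by rewrite in_itv/= andbT ltW// (le_lt_trans (s0 j)).
rewrite [X in \det X](_ : _ = \matrix_(i, j)
    \int[mu]_(t in [set` I j]) gamma_density (c i) t); last first.
  apply/matrixP => i j; rewrite !mxE /I; case: ltnP => jr; last first.
    by rewrite mul0r subr0 upper_gammaE.
  rewrite mul1r (@upper_gamma_split _ (s j) (s j.+1)) ?addrK//.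
  by apply/ltW/sI.
apply: (@det_functional_gt0 _ _ _ (fun i => gamma_density (c i))
  (fun j => [set` I j])) => [t tI|j a a_gt0|j].
(* The exponential depends on the column alone and factors out, leaving a generalized Vandermonde
   matrix. *)
- have -> : \matrix_(i, j) gamma_density (c i) (t j) =
      \matrix_(i, j) (expR (- t j) *
        (\matrix_(i < r.+1, j < r.+1) t j `^ (c i - 1)) i j).
    by apply/matrixP => i j; rewrite !mxE mulrC.
  rewrite det_scale_cols mulrCA pmulr_rgt0; last first.
    by apply: prodr_gt0 => j _; exact: expR_gt0.
  apply: gen_vandermonde => [i j ij|j|i j ij].
  + by rewrite ltrD2r cD.
  + exact: le_lt_trans (s0 j) (I_gt _ _ (tI j)).
  + exact: le_lt_trans (I_le _ _ _ ij (tI i)) (I_gt _ _ (tI j)).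
- have mI : measurable [set` I j] by exact: measurable_itv.
  have [ia aE] := Rintegral_lincomb [set` I j] _ a _ mI (fun i => iI i j).
  rewrite (_ : \sum_i _ = \sum_i a i *
    \int[mu]_(t in [set` I j]) gamma_density (c i) t); last first.
    by apply: eq_bigr => i _; rewrite mxE.
  rewrite -aE; apply: (@Rintegral_gt0 _ _ _ 0) => //.
  + rewrite lebesgue_measure_itv /I/=; case: ltnP => jr/=; last by rewrite !ltry.
    by rewrite lte_fin sI// -EFinB lte_fin subr_gt0 sI.
  + by move=> t tI; exact/ltW/a_gt0.
  + by move=> t tI _; exact: a_gt0.
- case: (ltnP j.+1 r.+1) => jr.
    exists (s j.+1); rewrite /= itv_boundlr/= jr bnd_simp lexx andbT.
    exact: sI.
  exists (s j + 1); rewrite /= itv_boundlr/= ltnNge jr/= bnd_simp andbT.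
  by rewrite ltrDl.
Qed.

End UpperGamma.

(** * The two second-order inequalities for part (i) *)

Section UpperGammaInequalities.
Context {R : realType}.
Local Notation mu := (@lebesgue_measure R).
Implicit Types c x y : R.
Local Notation G c x := (upper_gamma c x%:E).

(** The determinant sign for [r = 2] is negative. The weak form admits [x = y], since the quantiles
    it is applied to are only known to be weakly ordered. *)
Lemma upper_gamma_tp2 (a b x y : R) : 0 < b -> b < a -> 0 <= x -> x <= y ->
  G a x * G b y <= G a y * G b x.
Proof.
move=> b0 ba x0; rewrite le_eqVlt => /predU1P[->//|xy].
have a0 := lt_trans b0 ba.
pose s (u v : R) (i : 'I_2) := if i == ord0 then u else v.
have ord2 (i j : 'I_2) : (i < j)%N -> i = ord0 /\ j = ord_max.
  by case: i j => [[|[|//]] ?] [[|[|//]] ?]//= _; split; apply/val_inj.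
have := @det_upper_gamma R 2 (s a b) (s x y).
rewrite det_mx2 !mxE/= expr1 mulN1r oppr_gt0 subr_lt0 => H; apply/ltW/H.
- by move=> i; rewrite /s; case: ifP.
- by move=> i j /ord2[-> ->].
- by move=> i; rewrite /s; case: ifP => // _; rewrite (le_trans x0)// ltW.
- by move=> i j /ord2[-> ->].
Qed.

(* Chebyshev's integral inequality: with m = G (s + b) x / G s x and t0 = m^(1/b),
   the product (t^a - t0^a) (t^b - m) is positive away from t0. *)
Lemma upper_gamma_lcvx (a b s x : R) : 0 < a -> 0 < b -> 0 < s -> 0 <= x ->
  G (s + a) x * G (s + b) x < G (s + a + b) x * G s x.
Proof.
move=> a0 b0 s0 x0.
have Gs := upper_gamma_gt0 s x s0 x0.
have Gsb := upper_gamma_gt0 (s + b) x (addr_gt0 s0 b0) x0.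
pose m := G (s + b) x / G s x.
have m0 : 0 < m by exact: divr_gt0.
pose t0 := m `^ b^-1.
have t00 : 0 < t0 by exact: powR_gt0.
have t0b : t0 `^ b = m by rewrite /t0 -powRrM mulVf ?powRr1// ?ltW// gt_eqF.
pose n := t0 `^ a.
have iG c : 0 < c -> mu.-integrable `]x, +oo[ (EFin \o gamma_density c).
  move=> c0; apply: integrable_gamma_density => // t /=.
  by rewrite !in_itv/= !andbT => /ltW; exact: le_trans.
(* Shapes and coefficients of the four gamma densities obtained by expanding [(t]^ a - n) * (t
   [^ b - m)] against the density of shape [s]. *)
pose e := [:: s + a + b; s + a; s + b; s].
pose k := [:: 1; - m; - n; n * m].
have eG (i : 'I_4) : 0 < nth 0 e i.
  by case: i => [[|[|[|[|//]]]] ?] /=; rewrite ?addr_gt0.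
have mI : measurable (`]x, +oo[%classic : set R) by [].
have [ik kE] := Rintegral_lincomb `]x, +oo[ 4 (fun i => nth 0 k i)
  (fun i => gamma_density (nth 0 e i)) mI (fun i => iG _ (eG i)).
have fE t : 0 < t -> \sum_(i < 4) nth 0 k i * gamma_density (nth 0 e i) t =
    (t `^ a - n) * (t `^ b - m) * gamma_density s t.
  move=> t_gt0; rewrite !big_ord_recl big_ord0 /=.
  by rewrite !gamma_densityD//; ring.
have f_gt0 t : 0 < t -> t != t0 -> 0 < (t `^ a - n) * (t `^ b - m).
  move=> t_gt0 tt0; rewrite /n -t0b; have [lt_t|lt_t] := ltP t t0.
    by rewrite nmulr_rgt0 subr_lt0 gt0_ltr_powR// nnegrE ltW.
  by rewrite mulr_gt0// subr_gt0 gt0_ltr_powR ?nnegrE ?ltW// lt_neqAle eq_sym tt0.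
have : 0 < \int[mu]_(t in `]x, +oo[)
    \sum_(i < 4) nth 0 k i * gamma_density (nth 0 e i) t.
  apply: (@Rintegral_gt0 _ _ _ t0) => //.
  - by rewrite lebesgue_measure_itv/= !ltry.
  - move=> t /=; rewrite in_itv/= andbT => /(le_lt_trans x0) t_gt0.
    rewrite fE//; have [->|tt0] := eqVneq t t0.
      by rewrite -/n subrr !mul0r.
    by rewrite mulr_ge0 ?gamma_density_ge0// ltW// f_gt0.
  - move=> t /=; rewrite in_itv/= andbT => /(le_lt_trans x0) t_gt0 tt0.
    by rewrite fE// mulr_gt0 ?gamma_density_gt0// f_gt0.
have sa0 := addr_gt0 s0 a0.
rewrite kE !big_ord_recl big_ord0 /= -!upper_gammaE//; try exact: addr_gt0.
(* This choice of [m] makes the two terms containing [n] cancel. *)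
have mE : m * G s x = G (s + b) x by rewrite /m divfK// gt_eqF.
rewrite -mE => H.
have {}H : m * G (s + a) x < G (s + a + b) x by lra.
by rewrite mulrA ltr_pM2r// mulrC.
Qed.

End UpperGammaInequalities.

(** * Existence and finiteness of the quantile *)

Section Quantile.
Context {R : realType}.
Local Notation mu := (@lebesgue_measure R).
Implicit Types c u w x y : R.
Local Notation G c x := (upper_gamma c x%:E).

(** Markov's inequality: the extra factor [t] in the integrand exceeds [x] on the domain. It
    provides an explicit point where the tail is small. *)
Lemma upper_gamma_markov u x : 0 < u -> 0 < x -> x * G u x <= G (u + 1) x.
Proof.
move=> u0 x0; rewrite !upper_gammaE ?addr_gt0//; try exact: ltW.
have iG c : 0 < c -> mu.-integrable `]x, +oo[ (EFin \o gamma_density c).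
  move=> c0; apply: integrable_gamma_density => // t /=.
  by rewrite !in_itv/= !andbT => /ltW; apply: le_trans; exact: ltW.
rewrite -RintegralZl//; last exact: iG.
apply: le_Rintegral => //.
- exact: (integrableZl _ x (iG _ u0)).
- by apply: iG; rewrite addr_gt0.
- move=> t /=; rewrite in_itv/= andbT => xt; have t0 := lt_trans x0 xt.
  by rewrite gamma_densityD// powRr1 ?ler_wpM2r ?gamma_density_ge0// ltW.
Qed.

Lemma Qgamma_surj u w : 0 < u -> 0 < w <= 1 ->
  exists2 x, 0 <= x & Qgamma u x%:E = w.
Proof.
move=> u0 /andP[w0 w1].
have g0 := gamma_gt0 u u0.
have g10 : 0 < gamma (u + 1) by rewrite gamma_gt0// addr_gt0.
(* Chosen so that the Markov bound gives [Qgamma u N%:E <= w]; the intermediate value theorem then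
   applies on [[0, N]]. *)
pose N := gamma (u + 1) / (w * gamma u).
have N0 : 0 < N by rewrite divr_gt0// mulr_gt0.
have GN : G u N <= w * gamma u.
  rewrite -(ler_pM2l N0) (le_trans (upper_gamma_markov u N u0 N0))//.
  rewrite /N divfK ?gt_eqF ?mulr_gt0//.
  by apply: upper_gamma_nincr => //; rewrite ?addr_gt0// ltW.
have iN : mu.-integrable `[0, N] (EFin \o gamma_density u).
  apply: integrable_gamma_density => // t /=.
  by rewrite !in_itv/= andbT => /andP[].
have FE y : 0 <= y -> \int[mu]_(t in `[0, y]) gamma_density u t = gamma u - G u y.
  move=> y0; rewrite /gamma (upper_gamma_split u 0 y)// addrK.
  rewrite Rintegral_itv_obnd_cbnd//; apply: integrable_gamma_density => // t /=.
  by rewrite !in_itv/= andbT => /andP[/ltW].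
have [|y yN yE] := IVT (v := gamma u - w * gamma u) (ltW N0)
    (parameterized_integral_continuous (ltW N0) iN).
- rewrite /parameterized_integral !FE ?(ltW N0)//.
  have -> : gamma u - G u 0 = 0 by rewrite /gamma subrr.
  rewrite min_l ?max_r ?subr_ge0 ?upper_gamma_nincr ?(ltW N0)//.
  by rewrite ler_piMl ?(ltW g0)//= lerD2l lerN2.
- move: yN; rewrite in_itv/= => /andP[y0 _]; exists y => //.
  move: yE; rewrite /parameterized_integral FE// => /addrI/oppr_inj.
  by rewrite /Qgamma => ->; rewrite mulfK// gt_eqF.
Qed.

(** Surjectivity makes the partial inverse a genuine right inverse with nonnegative values; the
    value [+oo] is excluded because [Qgamma] is 0 there while [w] is positive. *)
Lemma Qgamma_invP u w : 0 < u -> 0 < w <= 1 ->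
  exists x, [/\ 0 <= x, Qgamma_inv u w = x%:E & Qgamma u x%:E = w].
Proof.
move=> u0 w01; have [x x0 xw] := Qgamma_surj u w u0 w01.
have wQ : w \in Qgamma u @` [set v | (0 <= v)%E].
  by rewrite inE; exists x%:E.
have QK : Qgamma u (Qgamma_inv u w) = w by exact: pinvK.
have : (0 <= Qgamma_inv u w)%E.
  have sub := @surjpinv_image_sub _ _ (fun=> +oo%E) [set v | (0 <= v)%E]
    (Qgamma u @` [set v | (0 <= v)%E]) (Qgamma u) (fun _ h => h).
  by apply: (sub (Qgamma_inv u w)); exists w => //; rewrite inE in wQ.
case: (Qgamma_inv u w) QK => [y yw y0||//]; first by exists y.
by rewrite /Qgamma upper_gammay mul0r => w0; move: w01; rewrite -w0 ltxx.
Qed.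
End Quantile.

(** * Quantile monotonicity and the two kernels *)

Section Kernels.
Context {R : realType}.
Implicit Types c u v w x y : R.

Lemma Qgamma_nincr u x y : 0 < u -> 0 <= x -> x <= y ->
  Qgamma u y%:E <= Qgamma u x%:E.
Proof.
move=> u0 x0 xy; rewrite ler_pM2r ?invr_gt0 ?gamma_gt0//.
exact: upper_gamma_nincr.
Qed.

Lemma Qgamma_ndecr_shape a b x : 0 < b -> b < a -> 0 <= x ->
  Qgamma b x%:E <= Qgamma a x%:E.
Proof.
move=> b0 ba x0; have a0 := lt_trans b0 ba.
rewrite ler_pdivrMr ?gamma_gt0// mulrAC ler_pdivlMr ?gamma_gt0//.
by rewrite mulrC; exact: (@upper_gamma_tp2 R a b 0 x).
Qed.

Lemma Qgamma_quantile_ndecr a b x y : 0 < b -> b < a -> 0 <= x -> 0 <= y ->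
  Qgamma a x%:E = Qgamma b y%:E -> y <= x.
Proof.
move=> b0 ba x0 y0 ab; rewrite leNgt; apply/negP => xy.
have := Qgamma_ndecr_shape a b x b0 ba x0; rewrite ab leNgt => /negP; apply.
by rewrite ltr_pM2r ?invr_gt0 ?gamma_gt0//; exact: upper_gamma_decr.
Qed.

Lemma STP2_gamma_calC v : 0 < v <= 1 ->
  STP2 `]0, +oo[ `]0, +oo[ (fun c u => gamma (c + u) * calC c u v).
Proof.
move=> v01.
pose x u := fine (Qgamma_inv u v).
have xP u : 0 < u ->
    [/\ 0 <= x u, Qgamma_inv u v = (x u)%:E & Qgamma u (x u)%:E = v].
  by move=> u0; have [y [y0 yE Qy]] := Qgamma_invP u v u0 v01; rewrite /x yE.
have KE c u : 0 < c -> 0 < u ->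
    gamma (c + u) * calC c u v = upper_gamma (c + u) (x u)%:E.
  move=> c0 u0; have [_ xE _] := xP u u0.
  by rewrite /calC xE /Qgamma mulrC divfK// gt_eqF// gamma_gt0// addr_gt0.
move=> r c u r12 [c0 cD] [u0 uD].
have {}c0 i : 0 < c i by have := c0 i; rewrite /= in_itv/= andbT.
have {}u0 i : 0 < u i by have := u0 i; rewrite /= in_itv/= andbT.
rewrite /kernel_det (_ : \matrix_(i, j) _ =
    \matrix_(i, j) upper_gamma (c i + u j) (x (u j))%:E); last first.
  by apply/matrixP => i j; rewrite !mxE KE.
case: r c u r12 c0 cD u0 uD => [|[|[|//]]] c u // _ c0 cD u0 uD.
  rewrite det_mx11 !mxE; have [x0 _ _] := xP _ (u0 0).
  by rewrite upper_gamma_gt0// addr_gt0.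
rewrite det_mx2 !mxE subr_gt0.
have {}cD : c ord_max < c ord0 by exact: cD.
have {}uD : u ord_max < u ord0 by exact: uD.
move: (c0 ord0) (c0 ord_max) (u0 ord0) (u0 ord_max) cD uD.
move: (c ord0) (c ord_max) (u ord0) (u ord_max) => c1 c2 u1 u2 {c u c0 u0}.
move=> c10 c20 u10 u20 c21 u21.
have [x10 _ Q1] := xP u1 u10; have [x20 _ Q2] := xP u2 u20.
move: (x u1) (x u2) x10 Q1 x20 Q2 => x1 x2 x10 Q1 x20 Q2.
have x21 : x2 <= x1.
  by apply: (Qgamma_quantile_ndecr u1 u2) => //; rewrite Q1 Q2.
have cu c u : 0 < c -> 0 < u -> 0 < c + u by exact: addr_gt0.
have G0 c u y : 0 < c -> 0 < u -> 0 <= y -> 0 < upper_gamma (c + u) y%:E.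
  by move=> *; apply: upper_gamma_gt0 => //; exact: cu.
(* With base [c2 + u2] and these increments the four shapes are the sums of a [c] and a [u], all at
   the common limit [x1]. *)
have := @upper_gamma_lcvx R (c1 - c2) (u1 - u2) (c2 + u2) x1.
rewrite !subr_gt0 (_ : c2 + u2 + (c1 - c2) + (u1 - u2) = c1 + u1); last ring.
rewrite (_ : c2 + u2 + (c1 - c2) = c1 + u2); last ring.
rewrite (_ : c2 + u2 + (u1 - u2) = c2 + u1); last ring.
move=> /(_ c21 u21 (cu _ _ c20 u20) x10) shape.
have quantile := @upper_gamma_tp2 R (c1 + u2) (c2 + u2) x2 x1.
have {}quantile := quantile (cu _ _ c20 u20) _ x20 x21.
rewrite ltrD2r in quantile; have {}quantile := quantile c21.
(* This positive factor occurs in both [shape] and [quantile], which can then be chained. *)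
rewrite -(ltr_pM2r (G0 c2 u2 x1 c20 u20 x10)).
apply: le_lt_trans (_ : _ <=
  upper_gamma (c1 + u2) x1%:E * upper_gamma (c2 + u2) x2%:E *
  upper_gamma (c2 + u1) x1%:E) _.
  by rewrite mulrAC ler_pM2r// G0.
rewrite mulrAC [ltRHS]mulrAC ltr_pM2r// G0//.
Qed.

Lemma SRRoo_calC u : 0 < u -> SRRoo `]0, +oo[ `]0, 1] (fun c v => calC c u v).
Proof.
move=> u0 r c v r1 [c0 cD] [v01 vD].
have {}c0 i : 0 < c i by have := c0 i; rewrite /= in_itv/= andbT.
have [x xP] := choice (fun j => Qgamma_invP u (v j) u0 (v01 j)).
have cu0 i : 0 < c i + u by exact: addr_gt0.
rewrite /kernel_det (_ : \matrix_(i, j) _ = \matrix_(i, j) ((gamma (c i + u))^-1 *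
    (\matrix_(i, j) upper_gamma (c i + u) (x j)%:E) i j)); last first.
  by apply/matrixP => i j; have [_ xE _] := xP j; rewrite !mxE /calC xE mulrC.
rewrite det_scale_rows mulrCA pmulr_rgt0; last first.
  by apply: prodr_gt0 => i _; rewrite invr_gt0 gamma_gt0.
apply: det_upper_gamma => // [i j ij|j|i j ij].
- by rewrite ltrD2r cD.
- by have [] := xP j.
- have [xi0 _ Qi] := xP i; have [xj0 _ Qj] := xP j.
  (* Quantiles in the wrong order would, by monotonicity of [Qgamma u], reverse the strict order of
     the [v j]. *)
  rewrite ltNge; apply/negP => xji; have := vD _ _ ij.
  by apply/negP; rewrite -leNgt -Qi -Qj; exact: Qgamma_nincr.
Qed.

End Kernels.

(* At v = 0 one has Q^{-1}(u,0) = +oo and C_c(u,0) = 0 for all c, u, so that no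
   strict inequality involving v = 0 can hold; v therefore ranges over ]0, 1]. *)
Theorem proposition4p3 (R : realType) :
  (forall v : R, 0 < v <= 1 ->
     STP2 `]0, +oo[ `]0, +oo[ (fun c u : R => gamma (c + u) * calC c u v)) /\
  (forall u : R, 0 < u ->
     SRRoo `]0, +oo[ `]0, 1] (fun c v : R => calC c u v)).
Proof. by split; [exact: STP2_gamma_calC|exact: SRRoo_calC]. Qed.
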